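(* Let $G$ be an expansive profinite group with endomorphism $\sigma$. Then there exists an $\ell\in\mathbb{N}$ such that $\sigma^\ell(G)$ is topologically conjugate to $\mathcal{A}^{\mathbb{N}}\times\mathcal{F}$, where $\mathcal{A}$ is a finite set and $\mathcal{F}$ is a finite set equipped with a bijective map $\sigma\colon\mathcal{F}\to\mathcal{F}$ having a fixed point.
   Context: $\mathbb{N}$ contains $0$. An expansive profinite group is a profinite group $G$ together with an expansive endomorphism, i.e. a continuous group homomorphism $\sigma\colon G\to G$ such that there is a neighborhood $U$ of $1$ with $\bigcap_{n\in\mathbb{N}}\sigma^{-n}(U)=1$. The subgroup $\sigma^\ell(G)$ carries the subspace topology and the restriction of $\sigma$. For a finite set $\mathcal{A}$, $\mathcal{A}^{\mathbb{N}}$ carries the product topology of the discrete topology and the shift $\sigma(a_0,a_1,\ldots)=(a_1,a_2,\ldots)$ (the full one-sided shift on $\mathcal{A}$). $\mathcal{F}$ is discrete, and $\mathcal{A}^{\mathbb{N}}\times\mathcal{F}$ carries the product topology and the product map. Two topological spaces $(X,\sigma)$, $(Y,\sigma)$ equipped with continuous self-maps are topologically conjugate if there is a homeomorphism $X\to Y$ commuting with the self-maps. *)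

(* Defs.v *)
From HB Require Import structures.
From mathcomp Require Import all_boot all_algebra.
From mathcomp Require Import all_classical topology.

Set Implicit Arguments.
Unset Strict Implicit.
Unset Printing Implicit Defensive.

Local Open Scope classical_set_scope.

(* Multiplicative analogue of topologicalZmodType: the library only has
   topological abelian groups.  Separation is not part of the structure. *)
HB.mixin Record isTopologicalGroup G & Topological G & Group G := {
  mulg_continuous : continuous (fun x : G * G => (x.1 * x.2)%g) ;
  invg_continuous : continuous (fun x : G => (x^-1)%g)
}.

#[short(type="topologicalGroupType")]
HB.structure Definition TopologicalGroup :=
  {G of Topological G & Group G & isTopologicalGroup G}.

(* The library's compact does not include the Hausdorff property. *)
Definition profinite (G : topologicalGroupType) : Prop :=
  [/\ compact [set: G], hausdorff_space G & totally_disconnected [set: G]].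

Definition expansive (G : topologicalGroupType) (sigma : G -> G) : Prop :=
  exists2 U : set G, nbhs (1%g : G) U &
    \bigcap_n (iter n sigma @^-1` U) = [set 1%g].

(* set_type A carries the subspace topology. *)
Definition restrict_self (T : Type) (A : set T) (f : T -> T)
    (fA : set_fun A A f) (x : set_type A) : set_type A :=
  SigSub (mem_set (fA _ (set_valP x))).

Lemma range_iter_stable (T : Type) (f : T -> T) (l : nat) :
  set_fun (range (iter l f)) (range (iter l f)) f.
Proof. by move=> _ [x _ <-]; exists (f x) => //; rewrite -iterSr. Qed.

Definition topologically_conjugate (X Y : topologicalType)
    (f : X -> X) (g : Y -> Y) : Prop :=
  exists (h : X -> Y) (k : Y -> X),
    [/\ continuous h, continuous k, cancel h k, cancel k h &
        forall x, h (f x) = g (h x)].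

Definition full_shift (A : choiceType) : topologicalType :=
  prod_topology (fun _ : nat => discrete_topology A).

Definition shift (A : choiceType) (a : full_shift A) : full_shift A :=
  fun n => a n.+1.

Definition map_pair (X Y : Type) (f : X -> X) (g : Y -> Y) (p : X * Y) :
    X * Y :=
  (f p.1, g p.2).

(* Main.v *)
Require Import Defs.
From HB Require Import structures.
From mathcomp Require Import all_boot all_fingroup all_algebra.
From mathcomp Require Import finmap all_classical topology.

Set Implicit Arguments.
Unset Strict Implicit.
Unset Printing Implicit Defensive.

(** Expansiveness yields a morphism [pi] from [G] to a finite group such that
    [g |-> (pi (sigma^n g))_n] is injective.  Follower sets of trivial words
    decrease, hence stabilise, so after passing to longer blocks the image is
    a Markov shift: all paths of the relation
    [E = {(pi g, pi (sigma g))}], a subgroup of the square of a finite group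
    [H].  The images [pi (sigma^l G)] decrease as well, and once they are
    constant [E] projects onto both factors.

    Now put [K = {h | E 1 h}], [K' = {h | E h 1}] and [D = K :&: K'].  Along a
    path, [x_{n+1} K] determines [x_n K'], so [x_n] is known modulo [D] from
    [x_n K] and [x_{n+1} K], and the [D]-coordinate is unconstrained.  Hence
    the paths of [E] are the product of the full shift on [D] and the paths of
    the relation induced on [H / K].  By induction on [#|H|] one reaches
    [K = 1], where [E] is the graph of a permutation fixing [1].  The
    resulting continuous bijection goes from a compact space to a Hausdorff
    space, so it is a homeomorphism. *)

(** * Paths of a group relation *)

Section GroupRelations.
Local Open Scope group_scope.

(** The first clause is the one-step subgroup test for [E] in the square of [gT]; nonemptiness comes
    from totality. *)
Definition group_rel (gT : finGroupType) (E : rel gT) : Prop :=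
  [/\ forall x y x' y', E x y -> E x' y' -> E (x^-1 * x') (y^-1 * y'),
      forall x, exists y, E x y & forall y, exists x, E x y].

Definition path_of (T : Type) (E : rel T) (x : nat -> T) : Prop :=
  forall n, E (x n) (x n.+1).

Section GroupRel.
Variables (gT : finGroupType) (E : rel gT).
Hypothesis EP : group_rel E.

Let ED x y x' y' : E x y -> E x' y' -> E (x^-1 * x') (y^-1 * y').
Proof. by case: EP => + _ _; apply. Qed.

Lemma group_rel1 : E 1 1.
Proof.
by case: EP => _ /(_ 1)[y E1y] _; have := ED E1y E1y; rewrite !mulVg.
Qed.

Lemma group_relV x y : E x y -> E x^-1 y^-1.
Proof. by move=> /ED /(_ group_rel1); rewrite !mulg1. Qed.

Lemma group_relM x y x' y' : E x y -> E x' y' -> E (x * x') (y * y').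
Proof. by move=> /group_relV /ED Exy /Exy; rewrite !invgK. Qed.

Definition followers1 := [set h | E 1 h].
Definition predecessors1 := [set h | E h 1].

Lemma followers1_group : group_set followers1.
Proof.
apply/group_setP; split=> [|x y]; rewrite !inE; first exact: group_rel1.
by move=> Ex Ey; have := group_relM Ex Ey; rewrite mulg1.
Qed.
Canonical followers1G := Group followers1_group.

Lemma predecessors1_group : group_set predecessors1.
Proof.
apply/group_setP; split=> [|x y]; rewrite !inE; first exact: group_rel1.
by move=> Ex Ey; have := group_relM Ex Ey; rewrite mulg1.
Qed.
Canonical predecessors1G := Group predecessors1_group.

(** Conjugating [(1, k)] by a pair [(w, x)] of [E] gives [(1, k ^ x)]; such a [w] exists because [E]
    projects onto the second factor. *)
Lemma followers1_norm x : x \in 'N(followers1).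
Proof.
case: EP => _ _ /(_ x)[w Ewx].
rewrite inE; apply/fintype.subsetP => _ /imsetP[k + ->]; rewrite !inE => E1k.
have := group_relM (group_relV Ewx) (group_relM E1k Ewx).
by rewrite mul1g mulVg.
Qed.

Lemma coset_followers1P x y :
  (coset followers1 x == coset followers1 y) = E 1 (x^-1 * y).
Proof.
apply/eqP/idP=> [exy|E1].
  have : coset followers1 (x^-1 * y) = 1.
    by rewrite morphM ?morphV ?followers1_norm//= exy mulVg.
  by move/coset_idr => /(_ (followers1_norm _)); rewrite inE.
have /coset_id : x^-1 * y \in followers1 by rewrite inE.
rewrite morphM ?morphV ?followers1_norm//= => e.
by apply/eqP; rewrite eq_mulVg1; apply/eqP.
Qed.

Definition quotient_rel : rel (coset_of followers1) := fun c d =>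
  [exists x, exists y,
    [&& E x y, coset followers1 x == c & coset followers1 y == d]].

Lemma quotient_relP c d : reflect (exists x y, [/\ E x y,
    coset followers1 x = c & coset followers1 y = d]) (quotient_rel c d).
Proof.
apply: (iffP existsP) => [[x /existsP[y /and3P[? /eqP ? /eqP ?]]]|[x [y [Exy <- <-]]]].
  by exists x, y.
by exists x; apply/existsP; exists y; rewrite Exy !eqxx.
Qed.

Lemma coset_surj (c : coset_of followers1) : exists x, coset followers1 x = c.
Proof. by case: (cosetP c) => x _ ->; exists x. Qed.

Lemma quotient_rel_group : group_rel quotient_rel.
Proof.
case: EP => _ El Er; split.
- move=> c d c' d' /quotient_relP[x [y [Exy <- <-]]].
  move=> /quotient_relP[x' [y' [Exy' <- <-]]]; apply/quotient_relP.
  exists (x^-1 * x'), (y^-1 * y').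
  by rewrite !morphM ?morphV ?followers1_norm//; split=> //; exact: ED.
- move=> c; have [x <-] := coset_surj c; have [y Exy] := El x.
  by exists (coset _ y); apply/quotient_relP; exists x, y.
- move=> c; have [y <-] := coset_surj c; have [x Exy] := Er y.
  by exists (coset _ x); apply/quotient_relP; exists x, y.
Qed.

Lemma card_coset_followers1 : followers1 != 1 ->
  (#|{: coset_of followers1}| < #|gT|)%N.
Proof.
move=> K1; have nK : followers1 <| [set: gT].
  by apply/fingroup.normalP; split=> [|x _]; [exact: finset.subsetT|exact/normP/followers1_norm].
rewrite -cardsT -(quotientT followers1G) -[X in (_ < X)%N]cardsT.
by apply: ltn_quotient => //; exact: finset.subsetT.
Qed.

(** Factors by which one entry of a path can be multiplied while both adjacent transitions
    survive. *)
Definition overlap := followers1G :&: predecessors1G.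

Lemma overlapP e : reflect (E 1 e /\ E e 1) (e \in overlap).
Proof. by rewrite !inE; exact: andP. Qed.

(* Any map restricting to a bijection on every coset of [overlap] would do; it
   need not be a morphism, whence a conjugacy that is only topological. *)
Definition coset_coord (h : gT) : [subg overlap] :=
  subg overlap ((repr (h *: overlap))^-1 * h).

Lemma coset_coord_bij h (d : [subg overlap]) :
  exists2 e, e \in overlap & coset_coord (h * e) = d.
Proof.
have : repr (h *: overlap) \in h *: overlap.
  by apply: (mem_repr h); exact: lcoset_refl.
set r := repr _ => /lcosetP[z zD rE].
exists (z * sgval d); first by rewrite groupM// subgP.
rewrite /coset_coord (_ : (h * _) *: overlap = h *: overlap); last first.
  by apply: lcoset_eqP; rewrite mem_lcoset !mulgA mulVg mul1g groupM ?subgP.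
by rewrite -/r rE (mulgA h) mulKg; exact: sgvalK.
Qed.

Lemma coset_coord_inj h e : e \in overlap ->
  coset_coord h = coset_coord (h * e) -> e = 1.
Proof.
move=> eD; rewrite /coset_coord (_ : (h * e) *: overlap = h *: overlap); last first.
  by apply: lcoset_eqP; rewrite mem_lcoset mulKg.
have : repr (h *: overlap) \in h *: overlap.
  by apply: (mem_repr h); exact: lcoset_refl.
set r := repr _ => /lcosetP[z zD rE].
move/(congr1 sgval).
(* [subg] can be undone by [sgval] only on [overlap], so membership is needed first. *)
have rh : r^-1 * h \in overlap by rewrite rE invMg mulgKV groupV.
by rewrite mulgA !subgK ?(groupM rh eD)// -[X in X = _]mulg1 => /mulgI.
Qed.

End GroupRel.

(** Both codes look at a single letter: [alpha] is read at every position, [f] only at position 0,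
    since [tau] determines it from there on. *)
Theorem group_rel_coding (gT : finGroupType) (E : rel gT) : group_rel E ->
  exists (A F : finType) (alpha : gT -> A) (f : gT -> F) (tau : F -> F),
    [/\ bijective tau, exists p, tau p = p,
        forall x y, E x y -> f y = tau (f x),
        forall a q, exists x : nat -> gT,
          [/\ path_of E x, forall n, alpha (x n) = a n & f (x 0%N) = q] &
        forall x x' : nat -> gT, path_of E x -> path_of E x' ->
          (forall n, alpha (x n) = alpha (x' n)) -> f (x 0%N) = f (x' 0%N) ->
          x =1 x'].
Proof.
have [m] := ubnP #|gT|; elim: m gT E => // m IHm gT E ltm EP.
(* If 1 is followed only by 1, every letter has exactly one successor, so a path is determined by
   its first letter and [A] can be a point. *)
have [K1|/card_coset_followers1-/(_ EP) ltK] := eqVneq (followers1 E) 1.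
  case: (EP) => ED El Er.
  have Eu x y y' : E x y -> E x y' -> y = y'.
    move=> Exy Exy'; have := ED _ _ _ _ Exy Exy'; rewrite mulVg => E1.
    have : y^-1 * y' \in followers1 E by rewrite inE.
    by rewrite K1 => /set1P/eqP; rewrite -eq_mulVg1 => /eqP.
  have [tau tauP] := choice El.
  have tauE x y : E x y -> y = tau x by move=> /Eu; apply.
  have [rho rhoP] := choice Er.
  have rhoK : cancel rho tau by move=> y; exact/esym/tauE.
  exists unit, gT, (fun=> tt), id, tau; split=> //.
  - by exists rho => //; exact: canF_sym.
  - by exists 1; apply/esym/tauE/group_rel1.
  - move=> a q; exists (fun n => iter n tau q); split=> // n.
    by case: (a n).
  - move=> x x' Ex Ex' _ x0; elim=> // n IHn.
    by rewrite (tauE _ _ (Ex n)) IHn -(tauE _ _ (Ex' n)).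
have {IHm}[|A [F [alpha [f [tau [tau_bij tau_fix tauP cod_surj cod_inj]]]]]] :=
    IHm (coset_of (followers1 E)) (@quotient_rel _ E) _ (quotient_rel_group EP).
  exact: leq_trans ltK _.
exists ([subg overlap EP] * A)%type, F,
  (fun h => (coset_coord EP h, alpha (coset (followers1 E) h))),
  (fun h => f (coset (followers1 E) h)), tau.
have quotE x y : E x y ->
    quotient_rel (coset (followers1 E) x) (coset (followers1 E) y).
  by move=> Exy; apply/quotient_relP; exists x, y.
split=> //.
- by move=> x y /quotE /tauP.
- move=> a q; have [c [Ec ac fc]] := cod_surj (fun n => (a n).2) q.
  (* The last clause covers the whole coset [c n.+1], so the entries can be chosen independently of
     one another. *)
  have step n : exists x, [/\ coset (followers1 E) x = c n,
      coset_coord EP x = (a n).1 &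
      forall y, coset (followers1 E) y = c n.+1 -> E x y].
    have /quotient_relP[u [v [Euv uc vc]]] := Ec n.
    have [e /overlapP[E1e Ee1] ue] := coset_coord_bij u (a n).1.
    exists (u * e); split=> //.
      by rewrite -uc; apply/eqP; rewrite eq_sym coset_followers1P// mulKg.
    move=> y; rewrite -vc => /esym/eqP; rewrite coset_followers1P// => E1.
    (* [(u * e, y)] is the product of [(u, v)], [(e, 1)] and [(1, v^-1 * y)]. *)
    have := group_relM EP Euv (group_relM EP Ee1 E1).
    by rewrite mul1g mulKVg mulg1.
  have [x xP] := choice step; exists x; split.
  + by move=> n; have [_ _] := xP n; apply; have [] := xP n.+1.
  + move=> n; have [-> -> _] := xP n.
    by rewrite ac -surjective_pairing.
  + by have [->] := xP 0%N.
- move=> x x' Ex Ex' ax fx.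
  have cxx' n : E 1 ((x n)^-1 * x' n).
    rewrite -coset_followers1P//; apply/eqP.
    apply: (cod_inj (fun n => coset _ (x n)) (fun n => coset _ (x' n))) => //.
    + by move=> k; exact: quotE.
    + by move=> k; exact: quotE.
    + by move=> k; case: (ax k).
  move=> n.
  suff : (x n)^-1 * x' n = 1 by move/eqP; rewrite -eq_mulVg1 => /eqP.
  apply: (@coset_coord_inj _ _ EP (x n)).
    apply/overlapP; split=> //.
    (* The paths differ by elements of [followers1] at every position; used at [n.+1], this puts the
       quotient at [n] into [predecessors1] too. *)
    case: (EP) => /(_ _ _ _ _ (Ex n) (Ex' n)) Exx' _ _.
    have := group_relM EP Exx' (group_relV EP (cxx' n.+1)).
    by rewrite invg1 mulg1 mulgV.
  by rewrite mulKVg; case: (ax n).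
Qed.

End GroupRelations.

Local Open Scope classical_set_scope.

(** * Finite quotients of profinite groups *)

(** Otherwise the clopen neighbourhoods of [x], cut down to the complement of [W], generate a proper
    filter. Its cluster point lies outside the open set [W], yet some clopen neighbourhood of [x]
    avoids it. *)
Lemma clopen_shrink (T : topologicalType) (x : T) (W : set T) :
  compact [set: T] -> open W ->
  (forall y, ~ W y -> exists C, [/\ clopen C, C x & ~ C y]) ->
  exists C, [/\ clopen C, C x & C `<=` W].
Proof.
move=> cptT oW sepW; apply: contrapT => noC.
pose F := filter_from [set C : set T | clopen C /\ C x] (fun C => C `\` W).
have FF : ProperFilter F.
  apply: filter_from_proper; last first.
    move=> C [clC Cx]; apply: contrapT => /nonemptyPn; rewrite setD_eq0 => CW.
    by apply: noC; exists C.
  apply: filter_from_filter; first by exists setT; split=> //; exact: clopenT.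
  move=> C D [clC Cx] [clD Dx]; exists (C `&` D).
    by split; [exact: clopenI|split].
  by move=> y [[Cy Dy] Wy].
have [|y [_ Fy]] := cptT F FF; first by apply: filterT.
have Wy : ~ W y.
  move=> Wy; have [|z [nWz Wz]] := Fy (~` W) W _ (open_nbhs_nbhs (conj oW Wy)).
    by exists setT => [|? []//]; split=> //; exact: clopenT.
  exact: nWz.
have [C [clC Cx nCy]] := sepW y Wy.
have [||z [[Cz _] nCz]] := Fy (C `\` W) (~` C).
- by exists C.
- by apply: open_nbhs_nbhs; split=> //; case: (clopenC C clC).
- exact: nCz.
Qed.

Definition quasi_component (T : topologicalType) (x : T) : set T :=
  [set y | forall C, clopen C -> C x -> C y].

(* In a compact Hausdorff space quasi-components are connected, so total
   disconnectedness makes them singletons and clopen sets form a basis. *)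
Lemma quasi_component_closed (T : topologicalType) (x : T) :
  closed (quasi_component x).
Proof.
have -> : quasi_component x =
    \bigcap_(C in [set C : set T | clopen C /\ C x]) C.
  by apply/seteqP; split=> [y Qy C []|y Qy C clC Cx]; exact: Qy.
by apply: closed_bigI => C [[]].
Qed.

(** Normality gives an open [O] around [P] inside some [B] whose closure misses [R]. A clopen [C]
    around [x] avoiding the part of [closure B] outside [O] meets [O] in a clopen set, which then
    contains the whole quasi-component. *)
Lemma quasi_component_split (T : topologicalType) (x : T) (P R : set T) :
  compact [set: T] -> hausdorff_space T ->
  closed P -> closed R -> P `&` R = set0 -> quasi_component x = P `|` R ->
  P x -> R = set0.
Proof.
move=> cptT hT cP cR PR QE Px.
have : filter_from (set_nbhs P) closure (~` R).
  apply: (compact_normal hT cptT cP); apply/set_nbhsP; exists (~` R); split=> //.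
  - exact: closed_openC.
  - exact/disjoints_subset.
case=> B /set_nbhsP[O [oO PO OB]] BR.
have OR y : closure B y -> ~ R y by move=> /BR.
have [|y nWy|C [[oC cC] Cx CW]] := @clopen_shrink T x (O `|` ~` closure B) cptT.
- by apply: openU => //; exact/closed_openC/closed_closure.
- apply: contrapT => noC; apply: nWy.
  have : quasi_component x y.
    by move=> C clC Cx; apply: contrapT => nCy; apply: noC; exists C.
  by rewrite QE => -[/PO|Ry]; [left|right=> /OR].
have CO : C `&` O = C `&` closure B.
  apply/seteqP; split=> y [Cy].
    by move=> Oy; split=> //; exact/subset_closure/OB.
  by move=> By; split=> //; case: (CW y Cy).
apply/seteqP; split=> // y Ry.
have Qy : quasi_component x y by rewrite QE; right.
have [||_ Oy] := Qy (C `&` O).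
- split; first exact: openI.
  by rewrite CO; apply: closedI => //; exact: closed_closure.
- by split=> //; exact: PO.
by case: (OR y) => //; exact/subset_closure/OB.
Qed.

Lemma quasi_component_connected (T : topologicalType) (x : T) :
  compact [set: T] -> hausdorff_space T -> connected (quasi_component x).
Proof.
move=> cptT hT B B0 [C oC BC] [D cD BD].
have cB : closed B by rewrite BD; apply: closedI => //; exact: quasi_component_closed.
have cB' : closed (quasi_component x `\` B).
  rewrite BC setDIr setDv set0U setDE; apply: closedI; last exact: open_closedC.
  exact: quasi_component_closed.
have QE : quasi_component x = B `|` (quasi_component x `\` B).
  by rewrite setDUK// BC => ? [].
have dB : B `&` (quasi_component x `\` B) = set0 by apply/seteqP; split=> // y [By []].
have [Bx|nBx] := pselect (B x).
  by rewrite [RHS]QE (quasi_component_split cptT hT cB cB' dB QE Bx) setU0.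
have B'x : (quasi_component x `\` B) x by split=> // ? ?.
have := quasi_component_split cptT hT cB' cB.
rewrite setIC setUC => /(_ x dB QE B'x) B0'.
by move: B0; rewrite B0' => -[].
Qed.

Lemma profinite_clopen_nbhs (T : topologicalType) (x : T) (U : set T) :
  compact [set: T] -> hausdorff_space T -> totally_disconnected [set: T] ->
  nbhs x U -> exists C, [/\ clopen C, C x & C `<=` U].
Proof.
move=> cptT hT dT /nbhs_interior xU.
have [y nUy|C [clC Cx CU]] := @clopen_shrink T x _ cptT (@open_interior _ U).
  apply: contrapT => noC.
  have Qy : quasi_component x y.
    by move=> C clC Cx; apply: contrapT => nCy; apply: noC; exists C.
  have : connected_component [set: T] x y.
    exists (quasi_component x) => //; split=> //; exact: quasi_component_connected.
  by rewrite dT// => yx; apply: nUy; rewrite yx; exact: nbhs_singleton.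
by exists C; split=> //; apply: subset_trans CU _; exact: interior_subset.
Qed.

Definition locally_constant (X : topologicalType) (T : Type) (f : X -> T) :=
  forall x, \forall y \near x, f y = f x.

(** Compactness is applied along the filter of ever larger finite sets: any finite set containing
    [f x] contains the values near [x]. *)
Lemma locally_constant_finite_range (X : topologicalType) (T : choiceType)
    (f : X -> T) :
  compact [set: X] -> locally_constant f -> finite_set (range f).
Proof.
move=> /compact_near_coveringP cptX lf.
pose F := filter_from [set: {fset T}] (fun s => [set s' | (s `<=` s')%fset]).
have FF : Filter F.
  apply: filter_from_filter; first by exists fset0.
  by move=> s t _ _; exists (s `|` t)%fset => // u /=; rewrite fsubUset => /andP[].
have [|s _ /(_ s (fsubset_refl s)) fs] := cptX _ F (fun s x => f x \in s) FF.
  move=> x _; exists ([set y | f y = f x], [set s | f x \in s]).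
    split; first exact: lf.
    by exists [fset f x]%fset => // s /=; rewrite fsub1set.
  by case=> y s [/= -> ].
by apply: (sub_finite_set _ (finite_fset s)) => _ [x _ <-]; exact: fs.
Qed.

(** * The finite group acting on the translates of a clopen set *)

Section SyntacticQuotient.
Variables (G : topologicalGroupType) (C : set G).
Hypotheses (cptG : compact [set: G]) (clC : clopen C).

Let nearM (x y : G) (P : set G) : nbhs (x * y)%g P ->
  \forall x' \near x & y' \near y, P (x' * y')%g.
Proof. exact: (@mulg_continuous G (x, y)). Qed.

(** This is [x^-1 S]; the inverse makes it a right action, matching the composition order of
    permutations. *)
Definition translate (x : G) (S : set G) : set G := [set y | S (x * y)%g].

Lemma translateM x y S : translate (x * y)%g S = translate y (translate x S).
Proof. by apply/funext => z; rewrite /translate /= mulgA. Qed.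

Lemma translate1 S : translate 1%g S = S.
Proof. by apply/funext => z; rewrite /translate /= mul1g. Qed.

Lemma clopen_locally_constant : locally_constant C.
Proof.
case: clC => oC cC x; have [Cx|nCx] := pselect (C x).
  have : nbhs x C by exact: open_nbhs_nbhs.
  by apply: filterS => y Cy; apply/propext.
have : nbhs x (~` C) by apply: open_nbhs_nbhs; split=> //; exact: closed_openC.
by apply: filterS => y Cy; apply/propext.
Qed.

(** For each [y], membership of [x' * y'] in [C] is constant near [(x, y)]; compactness in [y]
    yields one neighbourhood of [x] for all [y]. *)
Lemma translate_locally_constant : locally_constant (translate ^~ C).
Proof.
move=> x; move/compact_near_coveringP : cptG.
move=> /(_ _ (nbhs x) (fun x' y => C (x' * y)%g = C (x * y)%g) _) xC.
have : \forall x' \near x, [set: G] `<=` (fun y => C (x' * y)%g = C (x * y)%g).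
  apply: xC => y _.
  case: (nearM (clopen_locally_constant (x * y)%g)) => -[V W] [/= xV yW] VW.
  exists (W, V) => // -[y' x'] [/= Wy' Vx'].
  rewrite (VW (x', y'))//= (VW (x, y'))//; split=> //; exact: nbhs_singleton.
by apply: filterS => x' Cx'; apply/funext => y; exact: Cx'.
Qed.

(** Uniformity in [x], again by compactness, makes [g'] and [g] act alike on all translates at
    once. *)
Lemma translate_uniformly_locally_constant g :
  \forall g' \near g, forall x, translate (x * g')%g C = translate (x * g)%g C.
Proof.
move/compact_near_coveringP : cptG.
move=> /(_ _ (nbhs g) (fun g' x => translate (x * g')%g C = translate (x * g)%g C) _) gC.
have : \forall g' \near g, [set: G] `<=`
    (fun x => translate (x * g')%g C = translate (x * g)%g C).
  apply: gC => x _.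
  case: (nearM (translate_locally_constant (x * g)%g)) => -[V W] [/= xV gW] VW.
  exists (V, W) => // -[x' g'] [/= Vx' Wg'].
  rewrite (VW (x', g'))//= (VW (x', g))//; split=> //; exact: nbhs_singleton.
by apply: filterS => g' Cg' x; exact: Cg'.
Qed.

Let orbit : {fset set G} := fset_set (range (translate ^~ C)).

Let orbitP S : reflect (exists x, translate x C = S) (S \in orbit).
Proof.
rewrite in_fset_set; last first.
  exact: locally_constant_finite_range translate_locally_constant.
by apply: (iffP idP) => [/set_mem[x _ <-]|[x <-]]; [exists x|apply/mem_set; exists x].
Qed.

Let orbit_translate g (S : orbit) : translate g (val S) \in orbit.
Proof.
by have /orbitP[x <-] := valP S; apply/orbitP; exists (x * g)%g; rewrite translateM.
Qed.

Let orbit_act g (S : orbit) : orbit := [` orbit_translate g S]%fset.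

Let orbit_act_inj g : injective (orbit_act g).
Proof.
move=> S S' /(congr1 (fun S => translate (g^-1)%g (val S))) /=.
by rewrite -!translateM mulgV !translate1 => /val_inj.
Qed.

(* [C] is closed under the kernel of the action of [G] on the finitely many
   translates of [C]. *)
Lemma syntactic_quotient : exists (gT : finGroupType) (pi : G -> gT),
  [/\ {morph pi : x y / (x * y)%g}, locally_constant pi &
      forall x, pi x = 1%g -> C 1%g -> C x].
Proof.
exists {perm orbit}, (fun g => perm (@orbit_act_inj g)); split.
- by move=> x y; apply/permP => S; rewrite permM !permE; apply: val_inj; exact: translateM.
- move=> g; apply: filterS (translate_uniformly_locally_constant g) => g' gg'.
  apply/permP => S; rewrite !permE; apply: val_inj => /=.
  by have /orbitP[x <-] := valP S; rewrite -!translateM.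
- move=> x /permP xE C1.
  have C_orbit : C \in orbit by apply/orbitP; exists 1%g; exact: translate1.
  move: (xE [` C_orbit]%fset) => /(congr1 val); rewrite permE perm1 /=.
  (* The equality between [C] and its translate is evaluated at 1. *)
  by move/(congr1 (@^~ 1%g)); rewrite /translate /= mulg1 => ->.
Qed.

End SyntacticQuotient.

(** * Markov presentation *)

Lemma morph_mulg1 (G H : groupType) (f : G -> H) :
  {morph f : x y / (x * y)%g} -> f 1%g = 1%g.
Proof. by move=> fM; apply: (mulgI (f 1%g)); rewrite -fM !mulg1. Qed.

Lemma morph_mulgV (G H : groupType) (f : G -> H) :
  {morph f : x y / (x * y)%g} -> {morph f : x / (x^-1)%g}.
Proof.
by move=> fM x; apply: (mulgI (f x)); rewrite -fM !mulgV morph_mulg1.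
Qed.

Lemma iter_morphM (G : groupType) (f : G -> G) n :
  {morph f : x y / (x * y)%g} -> {morph iter n f : x y / (x * y)%g}.
Proof. by move=> fM; elim: n => // n IHn x y /=; rewrite IHn fM. Qed.

Lemma iter_continuous (X : topologicalType) (f : X -> X) n :
  continuous f -> continuous (iter n f).
Proof.
move=> cf; elim: n => [|n IHn] x; first exact: cvg_id.
by apply: (@continuous_comp _ _ _ (iter n f) f); [exact: IHn|exact: cf].
Qed.

Lemma locally_constant_comp (X Y : topologicalType) (T : Type) (g : X -> Y)
    (f : Y -> T) :
  continuous g -> locally_constant f -> locally_constant (f \o g).
Proof. by move=> cg lf x; exact: (cg x _ (lf (g x))). Qed.

Lemma decreasing_sets_stabilize (T : finType) (f : nat -> {set T}) :
  (forall n, f n.+1 \subset f n) ->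
  exists m, forall n, (m <= n)%N -> f n = f m.
Proof.
move=> fS.
have ex_card : exists k, `[< exists n, #|f n| = k >].
  by exists #|f 0%N|; apply/asboolP; exists 0%N.
case: (ex_minnP ex_card) => _ /asboolP[m <-] min_m; exists m => n lemn.
apply/eqP; rewrite eqEcard min_m ?andbT; last by apply/asboolP; exists n.
by rewrite -(subnK lemn); elim: (n - m)%N => // k; exact: fintype.subset_trans (fS _).
Qed.

(** * Block maps and the Markov property *)

Section Blocks.
Variables (G : topologicalGroupType) (sigma : G -> G).
Hypotheses (sigmaM : {morph sigma : x y / (x * y)%g})
           (sigma_continuous : continuous sigma).
Variables (gT : finGroupType) (pi : G -> gT).
Hypotheses (piM : {morph pi : x y / (x * y)%g}) (pi_lc : locally_constant pi).

(** An iterated direct product keeps the reading of [m.+1] successive symbols a morphism to a finite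
    group. *)
Lemma block_quotient m : exists (hT : finGroupType) (rho : G -> hT),
  [/\ {morph rho : x y / (x * y)%g}, locally_constant rho &
      forall x y, rho x = rho y <->
        forall i, (i <= m)%N -> pi (iter i sigma x) = pi (iter i sigma y)].
Proof.
elim: m => [|m [hT [rho [rhoM rho_lc rhoE]]]].
  exists gT, pi; split=> // x y; split=> [e i|/(_ 0%N)]; last exact.
  by rewrite leqn0 => /eqP ->.
exists (hT * gT)%type, (fun x => (rho x, pi (iter m.+1 sigma x))); split.
- by move=> x y; rewrite rhoM iter_morphM// piM.
- move=> x; have lc := locally_constant_comp (@iter_continuous _ _ m.+1 sigma_continuous) pi_lc.
  by apply: filterS2 (rho_lc x) (lc x) => y /= -> ->.
- move=> x y; split=> [[/rhoE e1 e2] i|e].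
    by rewrite leq_eqVlt => /predU1P[->//|]; exact: e1.
  by congr pair; [apply/rhoE => i im; apply: e; exact: leqW|exact: e].
Qed.

Let vanishing j u := forall i, (i < j)%N -> pi (iter i sigma u) = 1%g.

(** The letters that can follow [j] trivial ones; dropping the first letter of a word shows that
    these sets decrease with [j]. *)
Let follower_set j : {set gT} :=
  [set h | `[< exists2 u, vanishing j u & pi (iter j sigma u) = h >]]%SET.

(** The Markov property is stated at the trivial letter only; multiplication in [G] extends it to
    all paths in [finite_path_lift]. *)
Lemma markov_quotient : exists (hT : finGroupType) (rho : G -> hT),
  [/\ {morph rho : x y / (x * y)%g}, locally_constant rho,
      forall x, rho x = 1%g -> pi x = 1%g &
      forall n v, rho v = 1%g -> exists u,
        (forall i, (i <= n)%N -> rho (iter i sigma u) = 1%g) /\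
        rho (iter n.+1 sigma u) = rho (sigma v)].
Proof.
have pi1 := morph_mulg1 piM.
have sigma1 i : iter i sigma 1%g = 1%g by apply: morph_mulg1; exact: iter_morphM.
have [j|m mP] := @decreasing_sets_stabilize _ follower_set.
  apply/fintype.subsetP => h; rewrite !inE => -[u u0 uh].
  exists (sigma u); last by rewrite -iterSr.
  by move=> i ij; rewrite -iterSr u0.
have [hT [rho [rhoM rho_lc rhoE]]] := block_quotient m.
have rho1 := morph_mulg1 rhoM.
have rho1P x : rho x = 1%g <-> vanishing m.+1 x.
  rewrite -rho1 rhoE; split=> x0 i im; first by rewrite x0// sigma1.
  by rewrite x0// sigma1.
(* The blocks of [sigma v] and [iter n.+1 sigma u] are trivial except for their
   last letters, for which the stable follower sets [follower_set m.+1] and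
   [follower_set (m.+1 + n)] agree. *)
exists hT, rho; split=> //.
  by move=> x /rho1P x0; exact: (x0 0%N).
move=> n v /rho1P v0.
have : pi (iter m.+1 sigma v) \in follower_set (m.+1 + n).
  rewrite mP; last by rewrite addSn; apply: leqW; exact: leq_addr.
  by rewrite -(mP m.+1)// !inE; exists v.
rewrite !inE => -[u u0 uv]; exists u; split=> [i lein|].
  apply/rho1P => j ltjm; rewrite -iterD u0//.
  exact: leq_add ltjm lein.
apply/rhoE => i; rewrite -iterD -iterSr leq_eqVlt => /predU1P[->|ltim].
  by rewrite -uv addnS.
by rewrite v0// u0// addnS addSn ltnS ltn_add2r.
Qed.

End Blocks.

(** * Lifting symbolic paths to points of the group *)

Section MarkovPaths.
Variables (G : topologicalGroupType) (sigma : G -> G).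
Hypotheses (cptG : compact [set: G])
           (sigmaM : {morph sigma : x y / (x * y)%g})
           (sigma_continuous : continuous sigma).
Variables (gT : finGroupType) (pi : G -> gT).
Hypotheses (piM : {morph pi : x y / (x * y)%g}) (pi_lc : locally_constant pi).
Hypothesis markov : forall n v, pi v = 1%g -> exists u,
  (forall i, (i <= n)%N -> pi (iter i sigma u) = 1%g) /\
  pi (iter n.+1 sigma u) = pi (sigma v).

Definition transition : rel gT :=
  fun x y => `[< exists g, pi g = x /\ pi (sigma g) = y >].

Lemma finite_path_lift x n : path_of transition x ->
  exists g, forall i, (i <= n)%N -> pi (iter i sigma g) = x i.
Proof.
move=> /(_ _)/asboolP xP; elim: n => [|n [g gx]].
  have [g [gx _]] := xP 0%N; by exists g => i; rewrite leqn0 => /eqP ->.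
have [h [hx hx']] := xP n.
(* [iter n sigma g] and [h] carry the same symbol, so their quotient [v] is trivial under [pi]. The
   resulting [u] is trivial up to [n] and corrects the next symbol of [g]. *)
have [|u [u0 uS]] := @markov n ((iter n sigma g)^-1 * h)%g.
  by rewrite piM morph_mulgV// gx// hx mulVg.
exists (g * u)%g => i; rewrite iter_morphM// piM leq_eqVlt => /predU1P[->|ltin].
  by rewrite uS -piM iterS -sigmaM mulVKg.
by rewrite gx// u0// mulg1.
Qed.

(** A cluster point of lifts of ever longer prefixes works: the symbol at time [i] is locally
    constant, so the cluster point shares it with some lift of index at least [i]. *)
Lemma path_lift x : path_of transition x ->
  exists g, forall i, pi (iter i sigma g) = x i.
Proof.
move=> xP; have [g gx] := choice (fun n => finite_path_lift n xP).
have [|h [_ hg]] := cptG (F := g @ \oo) _; first exact: filterT.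
exists h => i.
have [||_ [[k /= ik <-] /= <-]] := hg (g @` [set k | (i <= k)%N])
    [set h' | pi (iter i sigma h') = pi (iter i sigma h)].
- exists i => // k /= ik; by exists k.
- exact: (locally_constant_comp (@iter_continuous _ _ i sigma_continuous) pi_lc h).
- exact: gx.
Qed.

End MarkovPaths.

(** * The conjugacy *)

Lemma continuous_cluster_eq (X Y : topologicalType) (f : X -> Y) (p q : X) :
  continuous f -> hausdorff_space Y -> cluster (nbhs p) q -> f p = f q.
Proof.
move=> cf hY pq; apply: hY => A B fpA fqB.
by have [x [Ax Bx]] := pq _ _ (cf p _ fpA) (cf q _ fqB); exists (f x).
Qed.

Lemma hausdorff_prod (X Y : topologicalType) :
  hausdorff_space X -> hausdorff_space Y -> hausdorff_space (X * Y)%type.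
Proof.
move=> hX hY p q pq; rewrite (surjective_pairing p) (surjective_pairing q).
congr pair.
  by apply: continuous_cluster_eq pq => // x; exact: cvg_fst.
by apply: continuous_cluster_eq pq => // x; exact: cvg_snd.
Qed.

Lemma full_shift_hausdorff (A : choiceType) : hausdorff_space (full_shift A).
Proof.
apply: (@hausdorff_product nat (fun=> discrete_topology A)) => _.
exact: discrete_hausdorff.
Qed.

Lemma continuous_full_shift (X : topologicalType) (A : choiceType)
    (f : X -> full_shift A) :
  (forall n, locally_constant (fun x => f x n)) -> continuous f.
Proof.
move=> lf x; apply/cvg_sup => n.
move: x; apply/(@continuousP _ (initial_topology (@^~ n))) => _ [B ? <-].
rewrite openE => x Bx; rewrite /interior.
by apply: filterS (lf n x) => y /= fy; rewrite /= fy.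
Qed.

Lemma continuous_discrete (X : topologicalType) (A : choiceType)
    (f : X -> discrete_topology A) :
  locally_constant f -> continuous f.
Proof.
by move=> lf x B /nbhs_singleton Bx; apply: filterS (lf x) => y /= ->.
Qed.

Lemma compact_set_type (X : topologicalType) (A : set X) :
  compact A -> compact [set: set_type A].
Proof.
move=> cptA F FF _; have [|x [Ax Fx]] := cptA (set_val @ F) _.
  by apply: (@nearW _ F) => u; exact: set_valP.
exists (SigSub (mem_set Ax)); split=> // B N FB [_ [[W oW <-] /= Wx WN]].
have [||_ [[u Bu <-] Wu]] := Fx (set_val @` B) W.
- by rewrite /fmap /= ; apply: (filterS _ FB) => u Bu; exists u.
- exact: open_nbhs_nbhs.
- by exists u; split=> //; exact: WN.
Qed.

(** Preimages under [k] are images under [h], and [h] is a closed map: closed sets are compact, and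
    their compact images are closed in [Y]. *)
Lemma compact_hausdorff_inverse (X Y : topologicalType) (h : X -> Y) (k : Y -> X) :
  compact [set: X] -> hausdorff_space Y -> continuous h ->
  cancel h k -> cancel k h -> continuous k.
Proof.
move=> cptX hY ch hK kK; apply/continuous_closedP => A cA.
have -> : k @^-1` A = h @` A.
  by apply/seteqP; split=> [y Ay|_ [x Ax <-]] /=; [exists (k y)|rewrite hK].
apply: compact_closed => //; apply: continuous_compact.
  exact: continuous_subspaceT.
exact: subclosed_compact cA cptX _.
Qed.

(** * Stable stages and the coding map *)

Section MarkovConjugacy.
Variables (G : topologicalGroupType) (sigma : G -> G).
Hypotheses (cptG : compact [set: G])
           (sigmaM : {morph sigma : x y / (x * y)%g})
           (sigma_continuous : continuous sigma).
Variables (gT : finGroupType) (pi : G -> gT).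
Hypotheses (piM : {morph pi : x y / (x * y)%g}) (pi_lc : locally_constant pi).
Hypothesis markov : forall n v, pi v = 1%g -> exists u,
  (forall i, (i <= n)%N -> pi (iter i sigma u) = 1%g) /\
  pi (iter n.+1 sigma u) = pi (sigma v).
Hypothesis separating : forall x, (forall n, pi (iter n sigma x) = 1%g) -> x = 1%g.

Lemma separating_inj x y :
  (forall n, pi (iter n sigma x) = pi (iter n sigma y)) -> x = y.
Proof.
move=> xy; apply: (mulgI x^-1%g); rewrite mulVg; apply/esym/separating => n.
have sM := @iter_morphM _ _ n sigmaM.
by rewrite sM (morph_mulgV sM) piM (morph_mulgV piM) xy mulVg.
Qed.

Definition stage l : {set gT} := [set h | `[< exists g, pi (iter l sigma g) = h >]]%SET.

Lemma stageP l h : reflect (exists g, pi (iter l sigma g) = h) (h \in stage l).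
Proof. by rewrite finset.inE; exact: asboolP. Qed.

Lemma stage_group l : group_set (stage l).
Proof.
have sM := @iter_morphM _ _ l sigmaM.
apply/group_setP; split.
  by apply/stageP; exists 1%g; rewrite (morph_mulg1 sM) (morph_mulg1 piM).
move=> _ _ /stageP[g <-] /stageP[h <-]; apply/stageP.
by exists (g * h)%g; rewrite sM piM.
Qed.
Canonical stageG l := Group (stage_group l).

Section Stage.
Variable l : nat.
Hypothesis stageS : stage l.+1 = stage l.

(** The witness in [transition] ranges over all of [G]; that paths still come from the range of
    [iter l sigma] is shown in [stage_path_lift]. *)
Definition stage_transition : rel [subg stage l] :=
  fun x y => transition sigma pi (sgval x) (sgval y).

(** Stability serves both projections: successors found in [stage l.+1] lie in [stage l], and
    letters of [stage l], seen in [stage l.+1], have predecessors in [stage l]. *)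
Lemma stage_transition_group : group_rel stage_transition.
Proof.
split.
- move=> x y x' y' /asboolP[g [gx gy]] /asboolP[h [hx hy]]; apply/asboolP.
  exists (g^-1 * h)%g.
  by rewrite sigmaM (morph_mulgV sigmaM) !piM !(morph_mulgV piM) gx gy hx hy.
- move=> x; have /stageP[g gx] := subgP x.
  have yl : pi (sigma (iter l sigma g)) \in stage l.
    by rewrite -stageS; apply/stageP; exists g.
  exists (subg _ (pi (sigma (iter l sigma g)))); apply/asboolP.
  by exists (iter l sigma g); rewrite subgK.
- move=> y; have /stageP[g gy] : sgval y \in stage l.+1 by rewrite stageS subgP.
  exists (subg _ (pi (iter l sigma g))); apply/asboolP.
  by exists (iter l sigma g); rewrite subgK//; apply/stageP; exists g.
Qed.

Lemma stage_path_lift (x : nat -> [subg stage l]) : path_of stage_transition x ->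
  exists g, forall i, pi (iter i sigma (iter l sigma g)) = sgval (x i).
Proof.
move=> xP; have /stageP[g0 g0x] := subgP (x 0%N).
(* The orbit of [g0] supplies [l] letters leading up to [x 0]; if [g] lifts the extended path,
   [iter l sigma g] lifts [x]. *)
pose z i := if (i < l)%N then pi (iter i sigma g0) else sgval (x (i - l)%N).
(* Both formulas agree at [i = l], so the transition into [x 0] is one of the orbit of [g0]. *)
have zl i : (i <= l)%N -> z i = pi (iter i sigma g0).
  by rewrite leq_eqVlt /z => /predU1P[->|->//]; rewrite ltnn subnn g0x.
have [|g gz] := path_lift cptG sigmaM sigma_continuous piM pi_lc markov (x := z).
  move=> i; have [ltil|leli] := ltnP i l.
    by rewrite !zl// 1?ltnW//; apply/asboolP; exists (iter i sigma g0).
  by rewrite /z !ltnNge leqW// leli/= subSn//; exact: xP.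
by exists g => i; rewrite -iterD gz /z ltnNge leq_addl/= addnK.
Qed.

(** Total on [G], as [subg] sends values outside the stage to 1; agreement with [pi] is claimed only
    on the range of [iter l sigma]. *)
Definition stage_symbol (g : G) : [subg stage l] := subg (stage l) (pi g).

Lemma stage_symbolK g : range (iter l sigma) g ->
  sgval (stage_symbol g) = pi g.
Proof. by case=> h _ <-; rewrite subgK//; apply/stageP; exists h. Qed.

Lemma iter_range g n : range (iter l sigma) g -> range (iter l sigma) (iter n sigma g).
Proof. by case=> h _ <-; exists (iter n sigma h) => //; rewrite -!iterD addnC. Qed.

Lemma stage_symbol_path g : range (iter l sigma) g ->
  path_of stage_transition (fun n => stage_symbol (iter n sigma g)).
Proof.
move=> lg n; apply/asboolP; exists (iter n sigma g).
by rewrite !stage_symbolK//; exact: iter_range.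
Qed.

Lemma stage_symbol_inj g h :
  range (iter l sigma) g -> range (iter l sigma) h ->
  (forall n, stage_symbol (iter n sigma g) = stage_symbol (iter n sigma h)) ->
  g = h.
Proof.
move=> lg lh gh; apply: separating_inj => n.
by rewrite -!stage_symbolK ?gh//; exact: iter_range.
Qed.

Lemma stage_symbol_locally_constant n :
  locally_constant (fun g => stage_symbol (iter n sigma g)).
Proof.
move=> g; have := locally_constant_comp (@iter_continuous _ _ n sigma_continuous) pi_lc g.
by apply: filterS => h /= e; rewrite /stage_symbol e.
Qed.

Lemma stage_conjugacy : exists (A F : finType) (tau : F -> F),
  [/\ bijective tau, exists p : F, tau p = p &
      @topologically_conjugate (set_type (range (iter l sigma)))
        (full_shift A * discrete_topology F)%type
        (restrict_self (@range_iter_stable G sigma l))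
        (map_pair (@shift A) tau)].
Proof.
have [A [F [alpha [f [tau [tau_bij tau_fix tauP cod_surj cod_inj]]]]]] :=
  group_rel_coding stage_transition_group.
exists A, F, tau; split=> //.
pose X := set_type (range (iter l sigma)).
pose s (g : X) n : [subg stage l] := stage_symbol (iter n sigma (set_val g)).
have s_path g : path_of stage_transition (s g).
  by apply: stage_symbol_path; exact: set_valP.
have s_lc n : locally_constant (s ^~ n).
  apply: (locally_constant_comp _ (@stage_symbol_locally_constant n)).
  exact: initial_continuous.
pose h (g : X) : (full_shift A * discrete_topology F)%type :=
  (fun n => alpha (s g n), f (s g 0%N)).
have h_inj : injective h.
  move=> g g' [/funeqP ag fg]; apply: val_inj; apply: stage_symbol_inj.
  - exact: set_valP.
  - exact: set_valP.
  - by apply: (cod_inj (s g) (s g')) => //.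
(* Surjectivity composes two liftings: from a code to a path, then from the path to a point of the
   range. *)
have [k kK] : exists k, cancel k h.
  suff /choice[k kK] : forall y, exists g, h g = y by exists k.
  case=> a q; have [x [xP xa xq]] := cod_surj a q.
  have [g gx] := stage_path_lift xP.
  have lg : range (iter l sigma) (iter l sigma g) by exists g.
  have sx n : s (SigSub (mem_set lg)) n = x n.
    by apply: val_inj; rewrite /s /= stage_symbolK ?gx//; exact: iter_range.
  exists (SigSub (mem_set lg)); rewrite /h; congr pair; last by rewrite sx.
  by apply/funext => n; rewrite sx.
have hK : cancel h k by move=> g; apply: h_inj; rewrite kK.
have h1_continuous : continuous (fun g : X => (h g).1).
  apply: continuous_full_shift => n g.
  by apply: filterS (s_lc n g) => g' /= ->.
have h2_continuous : continuous (fun g : X => (h g).2).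
  by apply: continuous_discrete => g; apply: filterS (s_lc 0%N g) => g' /= ->.
have h_continuous : continuous h.
  by move=> g; exact: (cvg_pair (h1_continuous g) (h2_continuous g)).
exists h, k; split=> //.
  apply: compact_hausdorff_inverse kK => //.
    apply: compact_set_type; apply: continuous_compact => //.
    exact/continuous_subspaceT/iter_continuous.
  apply: hausdorff_prod; first exact: full_shift_hausdorff.
  exact: discrete_hausdorff.
move=> g.
have sS n : s (restrict_self (@range_iter_stable G sigma l) g) n = s g n.+1.
  by rewrite /s iterSr.
rewrite /h /map_pair /=; congr pair; last by rewrite sS; apply: tauP; exact: s_path.
by apply/funext => n; rewrite sS.
Qed.

End Stage.

Lemma markov_conjugacy : exists (l : nat) (A F : finType) (tau : F -> F),
  [/\ bijective tau, exists p : F, tau p = p &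
      @topologically_conjugate (set_type (range (iter l sigma)))
        (full_shift A * discrete_topology F)%type
        (restrict_self (@range_iter_stable G sigma l))
        (map_pair (@shift A) tau)].
Proof.
have [n|l lP] := @decreasing_sets_stabilize _ stage.
  apply/fintype.subsetP => _ /stageP[g <-]; apply/stageP; exists (sigma g).
  by rewrite -iterSr.
by exists l; apply: stage_conjugacy; exact: lP.
Qed.

End MarkovConjugacy.

Theorem theorem5p2 (G : topologicalGroupType) (sigma : {multiplicative G -> G})
    (profinite_G : profinite G)
    (sigma_continuous : continuous sigma)
    (sigma_expansive : expansive sigma) :
  exists (l : nat) (A F : finType) (tau : F -> F),
    [/\ bijective tau,
        exists p : F, tau p = p &
        @topologically_conjugate
          (set_type (range (iter l sigma)))
          (full_shift A * discrete_topology F)%type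
          (restrict_self (@range_iter_stable G sigma l))
          (map_pair (@shift A) tau)].
Proof.
have [cptG hG dG] := profinite_G; have [U U1 Usep] := sigma_expansive.
have sigmaM : {morph sigma : x y / (x * y)%g} by exact: gmulfM.
have [C [clC C1 CU]] := profinite_clopen_nbhs cptG hG dG U1.
have [gT0 [pi0 [pi0M pi0_lc pi0C]]] := syntactic_quotient cptG clC.
have [gT [pi [piM pi_lc pi_pi0 markov]]] :=
  markov_quotient sigmaM sigma_continuous pi0M pi0_lc.
apply: (markov_conjugacy cptG sigmaM sigma_continuous piM pi_lc markov) => x x1.
(* Trivial symbols at all times put every [iter n sigma x] in [C], hence in [U], and expansiveness
   applies. *)
suff : [set 1%g] x by [].
by rewrite -Usep => n _; apply: CU; apply: pi0C => //; exact/pi_pi0/x1.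
Qed.
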